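(* Let $f$ be a convex, differentiable function of $m$ blocks $x=(x_1,\dots,x_m)$ whose gradient is Lipschitz continuous with constant $L>0$, with finite $\min f$ and nonempty $\arg\min f$. Let $(\beta_k)_{k\ge0}\subseteq[0,\sqrt m)$ be non-increasing, let $0<c<1$ be fixed, and let $\gamma_k=\frac{2(1-\beta_k/\sqrt m)c}{L}$. Let $(x^k)_{k\ge0}$ be generated by the stochastic coordinate descent Heavy-ball scheme, and assume $$\bar R:=\sup_k\left\{\mathbb{E}\|x^k-\overline{x^k}\|^2\right\}<+\infty,$$ where $\overline{x^k}$ is the projection of $x^k$ onto $\arg\min f$. Then $$\mathbb{E}f(x^k)-\min f=O\left(\frac{4\bar R\cdot\sup_k\{\bar\varepsilon_k\}}{k}\right)\qquad(k\to\infty),$$ where $$\bar\delta_k:=\frac{\beta_k}{2\sqrt m\,\gamma_k}+\frac12\left(\frac{1-\beta_k/\sqrt m}{\gamma_k}-\frac L2\right),\qquad \bar\varepsilon_k:=\frac{4c\,\bar\delta_k^2}{(1-c)L}+\frac{8cm}{(1-c)L\gamma_k^2}.$$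
   Context: $\|\cdot\|$ is the Euclidean norm; $\nabla_i f$ is the partial gradient with respect to block $x_i$. The stochastic coordinate descent Heavy-ball scheme, started from arbitrary (deterministic) points $x^{-1},x^0$, at each iteration $k\ge0$ picks $i_k$ uniformly at random from $\{1,\dots,m\}$, independently of the past, and sets $$x_{i_k}^{k+1}=x_{i_k}^k-\gamma_k\nabla_{i_k}f(x^k)+\beta_k(x_{i_k}^k-x_{i_k}^{k-1}),\qquad x_i^{k+1}=x_i^k\ \text{ if } i\ne i_k.$$ $\mathbb{E}$ denotes total expectation. *)

(* Defs.v *)
From HB Require Import structures.
From mathcomp Require Import all_boot all_order all_algebra.
From mathcomp Require Import all_classical all_reals all_analysis.
Import Order.TTheory GRing.Theory Num.Theory.
Import numFieldNormedType.Exports.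

Set Implicit Arguments.
Unset Strict Implicit.
Unset Printing Implicit Defensive.

Local Open Scope classical_set_scope.
Local Open Scope ring_scope.

(* The normedModType norm `|x| on row vectors is the sup norm; differentiability
   does not depend on that choice, but the Lipschitz constant and the distances
   below do, hence a separate Euclidean norm. *)
Definition enorm (R : realType) (N : nat) (x : 'rV[R]_N) : R :=
  Num.sqrt (\sum_(j < N) x 0 j ^+ 2).

Definition grad (R : realType) (N : nat) (f : 'rV[R]_N -> R^o) (x : 'rV[R]_N) :
    'rV[R]_N :=
  \row_(j < N) 'D_(delta_mx 0 j) f x.

Definition argmin (R : realType) (T : Type) (f : T -> R) : set T :=
  [set x | forall y, f x <= f y].

(* The infimum is attained, hence is the minimum, as soon as argmin f is
   nonempty. *)
Definition minval (R : realType) (T : Type) (f : T -> R) : R := inf (range f).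

Definition is_proj (R : realType) (N : nat) (A : set 'rV[R]_N) (x y : 'rV[R]_N) :
    Prop :=
  A y /\ forall z, A z -> enorm (x - y) <= enorm (x - z).

(* For A nonempty, closed and convex, exactly one point satisfies is_proj A x;
   the default 0 is only used when no point does. *)
Definition proj (R : realType) (N : nat) (A : set 'rV[R]_N) (x : 'rV[R]_N) :
    'rV[R]_N :=
  xget 0 [set y | is_proj A x y].

(* A vector with m blocks of dimensions n 0, ..., n (m-1) is a row vector of
   length \sum_i n i; its i-th block is submxrow x i, and the partial gradient
   with respect to that block is the i-th block of the gradient. *)
Definition pgrad (R : realType) (m : nat) (n : 'I_m -> nat)
    (f : 'rV[R]_(\sum_i n i) -> R^o) (i : 'I_m) (x : 'rV[R]_(\sum_i n i)) :
    'rV[R]_(n i) :=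
  submxrow (grad f x) i.

(* As the starting points are deterministic, the past at iteration k is
   the sigma-algebra generated by i_0, ..., i_(k-1); since it is finite, it is
   enough to state independence on its atoms {i_0 = s_0, ..., i_(k-1) = s_(k-1)}. *)
Definition uniform_indep_past (R : realType) (d : measure_display)
    (Omega : measurableType d) (P : probability Omega R) (m : nat)
    (i : nat -> Omega -> 'I_m) : Prop :=
  [/\ forall k a, measurable [set w | i k w = a],
      forall k a, P [set w | i k w = a] = (m%:R^-1)%:E
    & forall k (s : 'I_k -> 'I_m) a,
        P ([set w | forall j : 'I_k, i j w = s j] `&` [set w | i k w = a]) =
        (P [set w | forall j : 'I_k, i j w = s j] * P [set w | i k w = a])%E].

(* x^(k-1), where xm1 is x^(-1). *)
Definition prev (T Omega : Type) (xm1 : T) (x : nat -> Omega -> T) (k : nat)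
    (w : Omega) : T :=
  if k is k'.+1 then x k' w else xm1.

Definition heavy_ball_scd (R : realType) (Omega : Type) (m : nat)
    (n : 'I_m -> nat) (f : 'rV[R]_(\sum_i n i) -> R^o) (gamma beta : nat -> R)
    (i : nat -> Omega -> 'I_m) (xm1 x0 : 'rV[R]_(\sum_i n i))
    (x : nat -> Omega -> 'rV[R]_(\sum_i n i)) : Prop :=
  (forall w, x 0%N w = x0) /\
  forall k w,
    submxrow (x k.+1 w) (i k w) =
      submxrow (x k w) (i k w) - gamma k *: pgrad f (i k w) (x k w)
      + beta k *: (submxrow (x k w) (i k w)
                   - submxrow (prev xm1 x k w) (i k w)) /\
    forall j, j != i k w -> submxrow (x k.+1 w) j = submxrow (x k w) j.

(* Extended-real valued, so that its finiteness is a genuine hypothesis. *)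
Definition Rbar (R : realType) (d : measure_display) (Omega : measurableType d)
    (P : probability Omega R) (N : nat) (f : 'rV[R]_N -> R)
    (x : nat -> Omega -> 'rV[R]_N) : \bar R :=
  ereal_sup (range (fun k : nat =>
    ('E_P[fun w => (enorm (x k w - proj (argmin f) (x k w)) ^+ 2)%R])%E)).

Definition delta_bar (R : realType) (m : nat) (L : R) (beta gamma : nat -> R)
    (k : nat) : R :=
  beta k / (2 * Num.sqrt m%:R * gamma k)
  + 2^-1 * ((1 - beta k / Num.sqrt m%:R) / gamma k - L / 2).

Definition eps_bar (R : realType) (m : nat) (L c : R) (beta gamma : nat -> R)
    (k : nat) : R :=
  4 * c * delta_bar m L beta gamma k ^+ 2 / ((1 - c) * L)
  + 8 * c * m%:R / ((1 - c) * L * gamma k ^+ 2).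

(* Main.v *)
Require Import Defs.
From HB Require Import structures.
From mathcomp Require Import all_boot all_order all_algebra.
From mathcomp Require Import all_classical all_reals all_analysis.
From mathcomp Require Import ring lra.
Import Order.TTheory GRing.Theory Num.Theory.
Import numFieldNormedType.Exports.
Set Implicit Arguments.
Unset Strict Implicit.
Unset Printing Implicit Defensive.
Local Open Scope classical_set_scope.
Local Open Scope ring_scope.

(** Write F_k = E f(x^k), D_k = E|x^k - x^(k-1)|^2 and M_k = E|grad f(x^k)|^2.
    The proof shows that a Lyapunov sequence satisfies E_k^2 <= K (E_k - E_(k+1)),
    which forces E_k = O(1/k).

    Decrease.  The move from x^k to x^(k+1) is the block i_k of
    beta d - gamma g, with d = x^k - x^(k-1) and g = grad f(x^k).  The descent
    lemma ([descent]) bounds f(x^(k+1)) by f(x^k) plus <g, move> + L/2 |move|^2;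
    the scheme expresses <g, move> through <move, d_(i_k)> and |move|^2
    ([block_step_dot]), and Young's inequality with parameter sqrt m splits
    the product <move, d_(i_k)>.  Since i_k is uniform and independent of the past, a
    random block of d carries 1/m of |d|^2 on average ([Ev_block]), which is what
    makes sqrt m the right parameter.  With delta_k the quantity delta_bar of the
    statement, the sequence E_k = F_k - min f + delta_k D_k thus decreases by at
    least a positive multiple of D_k + D_(k+1) ([expected_decrease]); this
    needs delta_k to be non-increasing, as it is because beta is ([weight_ni]).

    Gap.  Reading the scheme backwards, the block i_k of g is a combination of
    the move and of a block of d, so that averaging over the block bounds M_k by
    a multiple of D_k + D_(k+1) ([gradient_bound]).  Convexity gives
    f(x^k) - min f <= <g, x^k - p> with p the projection of x^k on the minimizers
    ([convex_grad]), and Young's inequality turns this into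
    2 t (F_k - min f) <= M_k + t^2 r for all t > 0, where r bounds the mean
    squared distances to the minimizers ([gap_le]).  Combined with the decrease,
    the choice t = E_k / r yields the quadratic recursion ([young_rate],
    [quadratic_decrease_rate]).  When r = 0 letting t grow shows that the gap
    vanishes ([gap_eq0]), which is what the O-estimate then requires.

    Expectations raise no integrability question: the variables at stage k
    depend only on i_0, ..., i_(k-1), which take finitely many values
    ([past_atoms]). *)

(** * Euclidean norm and projections *)

Section Euclid.
Context {R : realType} {N : nat}.
Implicit Types u v w : 'rV[R]_N.

Definition dotv u v : R := \sum_(j < N) u 0 j * v 0 j.

Lemma enorm_ge0 u : 0 <= enorm u.
Proof. exact: sqrtr_ge0. Qed.

Lemma enorm_sqr u : enorm u ^+ 2 = \sum_(j < N) u 0 j ^+ 2.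
Proof. by rewrite sqr_sqrtr// sumr_ge0// => j _; exact: sqr_ge0. Qed.

Lemma enormZ_sqr (a : R) u : enorm (a *: u) ^+ 2 = a ^+ 2 * enorm u ^+ 2.
Proof.
rewrite !enorm_sqr mulr_sumr; apply: eq_bigr => j _.
by rewrite mxE exprMn.
Qed.

Lemma dotvZr (a : R) u v : dotv u (a *: v) = a * dotv u v.
Proof. by rewrite mulr_sumr; apply: eq_bigr => j _; rewrite mxE mulrCA. Qed.

Lemma dotvBl u v w : dotv (u - v) w = dotv u w - dotv v w.
Proof.
by rewrite -sumrB; apply: eq_bigr => j _; rewrite !mxE mulrBl.
Qed.

Lemma dotvNr u v : dotv u (- v) = - dotv u v.
Proof. by rewrite -sumrN; apply: eq_bigr => j _; rewrite !mxE mulrN. Qed.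

(** Expand |u - t v|^2 >= 0; used in place of Cauchy-Schwarz because it survives
    taking expectations. *)
Lemma dotv_young (t : R) u v :
  2 * t * dotv u v <= enorm u ^+ 2 + t ^+ 2 * enorm v ^+ 2.
Proof.
rewrite !enorm_sqr !mulr_sumr -big_split/=; apply: ler_sum => j _.
have := sqr_ge0 (u 0 j - t * v 0 j); nra.
Qed.

Lemma coord_le_enorm u j : `|u 0 j| <= enorm u.
Proof.
rewrite -(ler_pXn2r (_ : 0 < 2)%N)// ?nnegrE ?enorm_ge0// enorm_sqr.
rewrite real_normK ?num_real// (bigD1 j)//= lerDl sumr_ge0// => k _.
exact: sqr_ge0.
Qed.

(** The topology of row vectors is that of the sup norm; this comparison makes
    Euclidean balls bounded for it. *)
Lemma norm_le_enorm u : `|u| <= enorm u.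
Proof.
rewrite -[`|u|]/(mx_norm u) mx_normrE; apply/bigmax_leP; split=> /=.
  exact: enorm_ge0.
by move=> [a j] _ /=; rewrite ord1 coord_le_enorm.
Qed.

Lemma enorm_continuous : continuous (@enorm R N : 'rV[R]_N -> R).
Proof.
have cS : continuous (fun u : 'rV[R]_N => \sum_(j < N) u 0 j ^+ 2).
  apply: continuous_big => [|j _ u]; first exact: add_continuous.
  apply: (@continuous_comp _ _ _ (fun v : 'rV[R]_N => v 0 j)
            (fun r : R => r ^+ 2)).
    exact: coord_continuous.
  exact: exprn_continuous.
by move=> u; apply: continuous_comp; [exact: cS|exact: sqrt_continuous].
Qed.

(** The distance to u attains its minimum on the compact set of the points of A
    that are no farther from u than some fixed p in A. *)
Lemma proj_exists (A : set 'rV[R]_N) u :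
  closed A -> A !=set0 -> is_proj A u (Defs.proj A u).
Proof.
move=> Ac [p Ap].
pose B := A `&` [set z | enorm (u - z) <= enorm (u - p)].
have cdist : continuous (fun z : 'rV[R]_N => enorm (u - z)).
  have cB : continuous (fun z : 'rV[R]_N => u - z).
    by move=> z; apply: continuousB; [exact: cst_continuous|exact: cvg_id].
  move=> z; apply: (@continuous_comp 'rV[R]_N 'rV[R]_N R
                      (fun z : 'rV[R]_N => u - z) (@enorm R N) z (cB z)).
  exact: enorm_continuous.
have Bc : closed B.
  apply: closedI => //.
  rewrite -[X in closed X]/((fun z => enorm (u - z)) @^-1`
                            [set r : R | r <= enorm (u - p)]).
  apply: preimage_closed => [z _|]; last exact: closed_le.
  exact: cdist.
have Bb : bounded_set B.
  exists (`|u| + enorm (u - p)); split; first exact: num_real.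
  move=> M uM z [_ /= zp]; apply: le_trans (ltW uM).
  rewrite -[z](subKr u) (le_trans (ler_normB _ _))// lerD2l.
  exact: le_trans (norm_le_enorm _) zp.
have [q /set_mem[Aq qp] qmin] := EVT_min_rV (ex_intro _ p (conj Ap (lexx _)))
  (bounded_closed_compact Bb Bc) (continuous_subspaceT cdist).
apply: (@xgetPex _ 0 [set y | is_proj A u y]); exists q; split => // z Az.
have [zp|/ltW pz] := leP (enorm (u - z)) (enorm (u - p)).
  by apply: qmin; apply/mem_set.
exact: le_trans qp pz.
Qed.

End Euclid.

(** * Smooth convex functions *)

Section Line.
Context {R : realType} {N : nat}.
Implicit Types (f : 'rV[R]_N -> R^o) (u v w : 'rV[R]_N).

Lemma derive_grad f u v : differentiable f u -> 'D_v f u = dotv (grad f u) v.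
Proof.
move=> df; rewrite deriveE// [X in 'd f u X](row_sum_delta v).
rewrite linear_sum; apply: eq_bigr => j _.
by rewrite linearZ/= mxE mulrC deriveE.
Qed.

Lemma is_derive_line f u v (t : R) : (forall y, differentiable f y) ->
  is_derive t (1 : R) (fun s : R => f (u + s *: v) : R)
    (dotv (grad f (u + t *: v)) v).
Proof.
move=> df; rewrite -derive_grad//.
(* Both difference quotients are the same function of the increment. *)
have E : (fun h : R => h^-1 *: (((fun s : R => f (u + s *: v)) \o shift t)
                                 (h *: (1 : R)) - f (u + t *: v))) =
    (fun h : R => h^-1 *: ((f \o shift (u + t *: v)) (h *: v)
                           - f (u + t *: v))).
  apply/funext => h /=; congr (_ *: (f _ - _)).
  by rewrite [h *: (1 : R)]mulr1 scalerDl addrCA.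
split.
  by rewrite /derivable E; exact: diff_derivable.
by rewrite /derive E.
Qed.

End Line.

(** Subtracting the parabola t dF(0) + K t^2 / 2 leaves a function with
    nonpositive derivative. *)
Lemma quadratic_growth (R : realType) (F dF : R -> R) (K : R) :
  (forall t, is_derive t (1 : R) F (dF t)) ->
  (forall t, 0 < t -> dF t - dF 0 <= K * t) ->
  F 1 <= F 0 + dF 0 + K / 2.
Proof.
move=> dFP hK.
pose h (t : R) : R := F t - (t * dF 0 + t ^+ 2 * (K / 2)).
have dh t : is_derive t (1 : R) h (dF t - (dF 0 + K * t)).
  rewrite /h; have dFt := dFP t.
  apply: is_derive_eq.
  rewrite /GRing.scale/=; lra.
have ch : continuous h.
  by move=> t; apply/differentiable_continuous/derivable1_diffP; case: (dh t).
have [t t01 E] := MVT (ltr01 : (0 : R) < 1) (fun t _ => dh t)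
                      (continuous_subspaceT ch).
move: t01; rewrite in_itv/= => /andP[t0 _].
have := hK t t0; move: E; rewrite /h expr0n/= expr1n; lra.
Qed.

Section Smooth.
Context {R : realType} {N : nat}.
Variables (f : 'rV[R]_N -> R^o) (L : R).
Hypothesis df : forall y, differentiable f y.
Hypothesis L0 : 0 < L.
Hypothesis gradL : forall y z, enorm (grad f y - grad f z) <= L * enorm (y - z).
Implicit Types (u v : 'rV[R]_N).

Lemma grad_dot_lip u v (t : R) : 0 < t ->
  `|dotv (grad f (u + t *: v) - grad f u) v| <= L * enorm v ^+ 2 * t.
Proof.
move=> t0; have Lt0 : 0 < L * t by rewrite mulr_gt0.
have lip : enorm (grad f (u + t *: v) - grad f u) ^+ 2 <=
           (L * t) ^+ 2 * enorm v ^+ 2.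
  have := gradL (u + t *: v) u.
  rewrite addrAC subrr add0r => h.
  rewrite exprMn -mulrA -enormZ_sqr -exprMn ler_pXn2r// nnegrE ?enorm_ge0//.
  by rewrite mulr_ge0 ?enorm_ge0// ltW.
set w := _ - _ in lip *.
rewrite ler_norml -(ler_pM2l Lt0) -[X in _ && X](ler_pM2l Lt0).
apply/andP; split; last by have := dotv_young (L * t) w v; nra.
have := dotv_young (L * t) w (- v).
have -> : enorm (- v) ^+ 2 = enorm v ^+ 2.
  by rewrite -scaleN1r enormZ_sqr sqrrN expr1n mul1r.
rewrite dotvNr; nra.
Qed.

(** [quadratic_growth] along the segment from u to u + v. *)
Lemma descent u v :
  f (u + v) <= f u + dotv (grad f u) v + L / 2 * enorm v ^+ 2.
Proof.
have := quadratic_growth (F := fun t : R => f (u + t *: v))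
  (dF := fun t => dotv (grad f (u + t *: v)) v) (K := L * enorm v ^+ 2).
rewrite scale1r scale0r addr0 => h; rewrite mulrAC; apply: h.
  by move=> t; exact: is_derive_line.
move=> t t0; rewrite -dotvBl; apply: le_trans (grad_dot_lip _ _ t0).
exact: ler_norm.
Qed.

(** The same bound for - f; it serves to get the gradient inequality of convex
    functions without passing to the limit in difference quotients. *)
Lemma ascent u v :
  f u + dotv (grad f u) v - L / 2 * enorm v ^+ 2 <= f (u + v).
Proof.
have := quadratic_growth (F := fun t : R => - (f (u + t *: v) : R))
  (dF := fun t => - dotv (grad f (u + t *: v)) v) (K := L * enorm v ^+ 2).
rewrite scale1r scale0r addr0 => h.
suff : - (f (u + v) : R) <=
    - f u - dotv (grad f u) v + L * enorm v ^+ 2 / 2 by lra.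
apply: h.
  by move=> t; apply: is_deriveN; exact: is_derive_line.
move=> t t0; rewrite -opprD -[X in _ + X]opprK opprK -dotvBl.
apply: le_trans (grad_dot_lip u v t0).
by rewrite -normrN ler_norm.
Qed.

(** At u + t v, convexity bounds f from above by its chord and [ascent] bounds it
    from below by its tangent up to O(t^2); divide by t and let t tend to 0. *)
Lemma convex_grad u v : convex_function setT f ->
  f u + dotv (grad f u) v <= f (u + v).
Proof.
move=> cf.
suff key (t : R) : 0 < t -> t < 1 ->
    f u + dotv (grad f u) v - t * (L / 2 * enorm v ^+ 2) <= f (u + v).
  apply/ler_addgt0Pr => e e0.
  set K := L / 2 * enorm v ^+ 2 in key.
  have K0 : 0 <= K by rewrite mulr_ge0// ?sqr_ge0// divr_ge0// ltW.
  (* A t in (0, 1) with t K <= e. *)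
  have := key (e / (K + e + 1)).
  have D0 : 0 < K + e + 1 by lra.
  rewrite divr_gt0// ltr_pdivrMr// mul1r.
  have -> : e < K + e + 1 by lra.
  move=> /(_ isT isT).
  have : e / (K + e + 1) * K <= e by rewrite mulrAC ler_pdivrMr//; nra.
  lra.
move=> t0 t1.
have E : t *: (u + v) + (1 - t) *: u = u + t *: v :> 'rV[R]_N.
  by apply/rowP => j; rewrite !mxE; ring.
have := cf (Itv01 (ltW t0) (ltW t1)) (u + v) u (in_setT _) (in_setT _).
rewrite convRE /=.
rewrite [X in f X](_ : _ = u + t *: v); last first.
  exact: E.
have := ascent u (t *: v); rewrite dotvZr enormZ_sqr /unstable.onem.
move=> h1 h2; rewrite -(ler_pM2l t0).
set K := enorm v ^+ 2 in h1 *. 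
nra.
Qed.
End Smooth.

(** * Random variables determined by past choices *)

Section Past.
Context {R : realType} {d : measure_display} {Omega : measurableType d}.
Variable P : probability Omega R.
Context {m : nat}.
Variable i : nat -> Omega -> 'I_m.
Hypothesis ui : uniform_indep_past P i.

(** Measurability with respect to i_0, ..., i_(k-1), stated pointwise: the
    choices have finite range, so nothing else is needed to integrate. *)
Definition past (T : Type) (k : nat) (X : Omega -> T) : Prop :=
  forall w w', (forall j, (j < k)%N -> i j w = i j w') -> X w = X w'.

Lemma past_cst T k (c : T) : past k (fun _ => c).
Proof. by []. Qed.

Lemma past_comp T U k (h : T -> U) X : past k X -> past k (fun w => h (X w)).
Proof. by move=> pX w w' /pX ->. Qed.

Lemma past_comp2 T U V k (h : T -> U -> V) X Y :
  past k X -> past k Y -> past k (fun w => h (X w) (Y w)).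
Proof. by move=> pX pY w w' ww'; rewrite (pX w w')// (pY w w'). Qed.

Lemma past_leq T k l (X : Omega -> T) : (k <= l)%N -> past k X -> past l X.
Proof.
by move=> kl pX w w' ww'; apply: pX => j jk; apply: ww'; exact: leq_trans kl.
Qed.

Lemma past_choice k : past k.+1 (i k).
Proof. by move=> w w'; exact. Qed.

Definition atom k (s : 'I_k -> 'I_m) : set Omega :=
  [set w | forall j : 'I_k, i j w = s j].

Lemma measurable_choice k a : measurable [set w | i k w = a].
Proof. by case: ui. Qed.

Lemma measurable_atom k (s : 'I_k -> 'I_m) : measurable (atom s).
Proof.
rewrite (_ : atom s = \bigcap_(j in [set: 'I_k]) [set w | i j w = s j]).
  by apply: fin_bigcap_measurable => // j _; exact: measurable_choice.
by apply/seteqP; split => w /= h j; [move=> _|]; exact: h.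
Qed.

(** X is constant on each of the finitely many atoms. *)
Lemma past_atoms k (X : Omega -> R) : past k X ->
  exists c : {ffun 'I_k -> 'I_m} -> R,
    X = fun w => \sum_s c s * \1_(atom s) w.
Proof.
move=> pX.
pose c (s : {ffun 'I_k -> 'I_m}) : R :=
  (* An empty atom contributes nothing, whatever its coefficient. *)
  if pselect (exists w, atom s w) is left e then X (projT1 (cid e)) else 0.
exists c; apply/funext => w.
pose s0 : {ffun 'I_k -> 'I_m} := [ffun j : 'I_k => i j w].
have ws0 : atom s0 w by move=> j; rewrite ffunE.
rewrite (bigD1 s0)//= big1 ?addr0 => [|s ss0]; last first.
  rewrite indicE memNset ?mulr0// => ws; move/eqP: ss0; apply.
  by apply/ffunP => j; rewrite ffunE ws.
rewrite indicE mem_set// mulr1 /c; case: pselect => [e|[]]; last by exists w.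
case: cid => w' /= w's0; apply: pX => j jk.
by rewrite (w's0 (Ordinal jk)) ffunE.
Qed.

Lemma integrable_indics (J : finType) (c : J -> R) (A : J -> set Omega) :
  (forall s, measurable (A s)) ->
  P.-integrable setT (EFin \o (fun w => \sum_s c s * \1_(A s) w)).
Proof.
move=> mA.
rewrite (_ : _ \o _ = fun w =>
    (\sum_(s <- index_enum J) ((c s)%:E * (\1_(A s) w)%:E))%E); last first.
  by apply/funext => w /=; rewrite -sumEFin.
apply: integrable_sum => // s _.
by apply: integrableZl => //; exact: integrable_indic.
Qed.

Lemma past_integrable k (X : Omega -> R) : past k X ->
  P.-integrable setT (EFin \o X).
Proof.
move=> /past_atoms[c ->]; apply: integrable_indics => s.
exact: measurable_atom.
Qed.

(** The real value of the expectation; it is meaningful for the variables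
    satisfying [past], whose expectation is finite by [past_expectation]. *)
Definition Ev (X : Omega -> R) : R := fine ('E_P[X])%E.

Lemma EvE X : Ev X = (\int[P]_w X w)%R.
Proof. by rewrite /Ev unlock. Qed.

Lemma past_expectation k (X : Omega -> R) : past k X -> ('E_P[X])%E = (Ev X)%:E.
Proof.
move=> pX; rewrite /Ev fineK// unlock integrable_fin_num//.
exact: (past_integrable pX).
Qed.

Lemma Ev_cst (c : R) : Ev (fun _ => c) = c.
Proof. by rewrite /Ev (expectation_cst P c). Qed.

Lemma Ev_le k X Y :
  past k X -> past k Y -> (forall w, X w <= Y w) -> Ev X <= Ev Y.
Proof.
move=> pX pY XY; rewrite !EvE; apply: le_Rintegral => //;
  exact: (past_integrable (k := k)).
Qed.

Lemma Ev_ge0 X : (forall w, 0 <= X w) -> 0 <= Ev X.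
Proof. by move=> X0; rewrite EvE Rintegral_ge0. Qed.

Lemma EvZ k (r : R) X : past k X -> Ev (fun w => r * X w) = r * Ev X.
Proof. by move=> pX; rewrite !EvE RintegralZl//; exact: past_integrable pX. Qed.

Lemma EvD k X Y :
  past k X -> past k Y -> Ev (fun w => X w + Y w) = Ev X + Ev Y.
Proof.
move=> pX pY; rewrite !EvE RintegralD//; exact: (past_integrable (k := k)).
Qed.

Lemma Ev_indics (J : finType) (c : J -> R) (A : J -> set Omega) :
  (forall s, measurable (A s)) ->
  Ev (fun w => \sum_s c s * \1_(A s) w) = \sum_s c s * fine (P (A s)).
Proof.
move=> mA; apply: EFin_inj.
have int_s s : P.-integrable setT (fun w => ((c s)%:E * (\1_(A s) w)%:E)%E).
  by apply: integrableZl => //; exact: integrable_indic.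
rewrite /Ev unlock fineK; last first.
  by apply: integrable_fin_num => //; exact: integrable_indics.
under eq_integral do rewrite -sumEFin.
rewrite integral_sum// -sumEFin; apply: eq_bigr => s _.
under eq_integral do rewrite EFinM.
rewrite integralZl//; last exact: integrable_indic.
by rewrite integral_indic// setIT EFinM fineK// fin_num_measure.
Qed.

Lemma past_sum k (J : finType) (X : J -> Omega -> R) :
  (forall a, past k (X a)) -> past k (fun w => \sum_a X a w).
Proof.
by move=> pX w w' ww'; apply: eq_bigr => a _; exact: pX.
Qed.

Lemma Ev_sum k (J : finType) (X : J -> Omega -> R) : (forall a, past k (X a)) ->
  Ev (fun w => \sum_a X a w) = \sum_a Ev (X a).
Proof.
move=> pX; elim: (index_enum J) => [|a s IH].
  by under [in LHS]eq_fun do rewrite big_nil; rewrite Ev_cst big_nil.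
under [in LHS]eq_fun do rewrite big_cons.
rewrite big_cons -IH (@EvD k)// => w w' ww'.
by apply: eq_bigr => b _; exact: pX.
Qed.

(** Decompose X on the atoms of its past: each of them is independent of the
    event i_k = a, whose probability is 1/m. *)
Lemma Ev_choice k a (X : Omega -> R) : past k X ->
  Ev (fun w => X w * \1_[set w | i k w = a] w) = m%:R^-1 * Ev X.
Proof.
move=> /past_atoms[c ->].
pose B := [set w | i k w = a].
under [in LHS]eq_fun => w.
  rewrite mulr_suml.
  under eq_bigr do rewrite -mulrA -[X in _ * X]/((\1_(atom _) \* \1_B) w)
                           -indicI.
  over.
rewrite !Ev_indics; last 2 first.
  move=> s; apply: measurableI; first exact: measurable_atom.
  exact: measurable_choice.
  by move=> s; exact: measurable_atom.
rewrite mulr_sumr; apply: eq_bigr => s _; rewrite mulrCA; congr (_ * _).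
case: ui => _ Pi Pind.
rewrite Pind Pi fineM// ?fin_num_measure//; last exact: measurable_atom.
by rewrite mulrC.
Qed.

(** Conditioning on the past, without conditional expectations: i_k may be
    replaced by the average over its m values. *)
Lemma Ev_step k (G : Omega -> 'I_m -> R) : (forall a, past k (G ^~ a)) ->
  Ev (fun w => G w (i k w)) = m%:R^-1 * Ev (fun w => \sum_a G w a).
Proof.
move=> pG.
rewrite (_ : (fun w => _) =
    fun w => \sum_a G w a * \1_[set w | i k w = a] w); last first.
  apply/funext => w; rewrite (bigD1 (i k w))//= big1 ?addr0 => [|a ai].
    by rewrite indicE mem_set ?mulr1.
  by rewrite indicE memNset ?mulr0//= => iw; move: ai; rewrite iw eqxx.
rewrite (Ev_sum pG) (@Ev_sum k.+1) => [|a]; last first.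
  move=> w w' ww'; rewrite (pG a w w') => [|j jk]; last first.
    by apply: ww'; exact: leqW.
  congr (_ * _); rewrite /= !indicE; congr ((nat_of_bool _)%:R).
  by apply/idP/idP; rewrite !in_setE/= (ww' k).
rewrite mulr_sumr; apply: eq_bigr => a _.
by rewrite Ev_choice.
Qed.

End Past.

(** * Minimizers *)

Section Argmin.
Context {R : realType}.

Lemma minvalE (T : Type) (f : T -> R) p : argmin f p -> minval f = f p.
Proof.
move=> fp; apply/eqP; rewrite eq_le; apply/andP; split.
  by apply: ge_inf; [exists (f p) => _ [y _ <-]; exact: fp|exists p].
by apply: lb_le_inf; [exists (f p), p|move=> _ [y _ <-]; exact: fp].
Qed.

Lemma argmin_closed N (f : 'rV[R]_N -> R^o) :
  (forall y, differentiable f y) -> argmin f !=set0 -> closed (argmin f).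
Proof.
move=> df [p fp].
have -> : argmin f = f @^-1` [set r : R | r <= f p].
  apply/seteqP; split=> y /= fy; first exact: fy.
  by move=> z; exact: le_trans fy (fp z).
apply: preimage_closed => [z _|]; last exact: closed_le.
exact: differentiable_continuous.
Qed.
End Argmin.

(** * From a quadratic decrease to a rate of order 1/k *)

Section Rate.
Context {R : realType}.

(** Morally 1/E_(k+1) - 1/E_k >= 1/K; the induction below avoids the inverses,
    as E_k may vanish. *)
Lemma quadratic_decrease_rate (E : nat -> R) (K : R) : 0 < K ->
  (forall k, 0 <= E k) ->
  (forall k, E k ^+ 2 <= K * (E k - E k.+1)) ->
  forall k, k%:R * E k <= K.
Proof.
move=> K0 E0 dec; elim=> [|k IH]; first by rewrite mul0r ltW.
have := dec k; have := E0 k; have := E0 k.+1.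
set a := E k in IH *; set b := E k.+1 => b0 a0 ab.
have ba : b <= a by have := sqr_ge0 a; nra.
have h : b * (K + a) <= K * a by nra.
have K1 : 0 < K + a by lra.
have k0 : 0 <= k%:R :> R by [].
rewrite -(ler_pM2r K1) -mulrA -natr1; nra.
Qed.

(** Taking t = E_k / r in the hypothesis gives
    E_k^2 <= (A r + 2 B E_0) (E_k - E_(k+1)). *)
Lemma young_rate (E : nat -> R) (A B r : R) : 0 < r -> 0 <= A -> 0 <= B ->
  (forall k, 0 <= E k) -> nonincreasing_seq E ->
  (forall k t, 0 < t ->
     2 * t * (E k - B * (E k - E k.+1)) <= A * (E k - E k.+1) + t ^+ 2 * r) ->
  exists K, forall k, k%:R * E k <= K.
Proof.
move=> r0 A0 B0 E0 niE hE.
(* The final 1 only makes K positive. *)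
pose K := A * r + 2 * B * E 0%N + 1.
have K0 : 0 < K.
  by rewrite /K; have := mulr_ge0 A0 (ltW r0); have := mulr_ge0 B0 (E0 0%N); lra.
exists K; apply: quadratic_decrease_rate => // k.
have [Ek0|Ek0] := eqVneq (E k) 0.
  have : E k.+1 <= E k by exact: niE.
  by have := E0 k.+1; rewrite Ek0; nra.
have {}Ek0 : 0 < E k by rewrite lt_neqAle eq_sym Ek0 E0.
have := hE k (E k / r) (divr_gt0 Ek0 r0).
have h0 : 0 <= E k - E k.+1 by rewrite subr_ge0; exact: niE.
have EE : E k <= E 0%N by exact: niE.
set h := E k - E k.+1 in h0 *; set e := E k in Ek0 EE *.
rewrite -(ler_pM2l r0).
have -> : r * (2 * (e / r) * (e - B * h)) = 2 * e * (e - B * h).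
  by field; rewrite gt_eqF.
have -> : r * (A * h + (e / r) ^+ 2 * r) = A * r * h + e ^+ 2.
  by field; rewrite gt_eqF.
have : e * (B * h) <= E 0%N * (B * h) by rewrite ler_wpM2r// mulr_ge0.
rewrite /K; nra.
Qed.
End Rate.

(** * One iteration of the scheme *)

Section Blocks.
Context {R : realType} {m : nat} {n : 'I_m -> nat}.
Implicit Types (v : 'rV[R]_(\sum_i n i)).

(** The vector v with all blocks but the a-th set to 0: working with full-length
    vectors avoids the dependent types of the blocks. *)
Definition block (a : 'I_m) v : 'rV[R]_(\sum_i n i) :=
  \row_j (if tagnat.sig1 j == a then v 0 j else 0).

Lemma sum_block v : \sum_a enorm (block a v) ^+ 2 = enorm v ^+ 2.
Proof.
transitivity (\sum_a \sum_j block a v 0 j ^+ 2).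
  by apply: eq_bigr => a _; exact: enorm_sqr.
transitivity (\sum_j \sum_a block a v 0 j ^+ 2); first exact: exchange_big.
rewrite enorm_sqr; apply: eq_bigr => j _ /=.
rewrite (bigD1 (tagnat.sig1 j))//= [X in _ + X]big1 => [|a aj]; rewrite mxE.
  by rewrite eqxx addr0.
by rewrite eq_sym (negbTE aj) expr0n.
Qed.

(** On the block a, g u = b d - D: this removes the gradient from the first-order
    term of the descent lemma. *)
Lemma block_step_dot a (b g : R) (d u : 'rV[R]_(\sum_i n i)) :
  let D := block a (b *: d - g *: u) in
  g * dotv u D = b * dotv D (block a d) - enorm D ^+ 2.
Proof.
rewrite /= enorm_sqr /dotv !mulr_sumr -sumrB; apply: eq_bigr => j _.
by rewrite !mxE; case: ifP => _; ring.
Qed.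

(** On the block a, g u is b d minus the step; use (p - q)^2 <= 2 p^2 + 2 q^2. *)
Lemma block_grad_le a (b g : R) (d u : 'rV[R]_(\sum_i n i)) :
  g ^+ 2 * enorm (block a u) ^+ 2 <=
  2 * b ^+ 2 * enorm (block a d) ^+ 2
  + 2 * enorm (block a (b *: d - g *: u)) ^+ 2.
Proof.
rewrite !enorm_sqr !mulr_sumr -big_split/=; apply: ler_sum => j _.
rewrite !mxE; case: ifP => _; last by rewrite !expr0n/= !mulr0 addr0.
have := sqr_ge0 (b * d 0 j + (b * d 0 j - g * u 0 j)); nra.
Qed.

Lemma heavy_ball_step (Omega : Type) (f : 'rV[R]_(\sum_i n i) -> R^o)
    (gamma beta : nat -> R) (i : nat -> Omega -> 'I_m)
    (xm1 x0 : 'rV[R]_(\sum_i n i)) (x : nat -> Omega -> 'rV[R]_(\sum_i n i)) k w :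
  heavy_ball_scd f gamma beta i xm1 x0 x ->
  x k.+1 w = x k w + block (i k w)
    (beta k *: (x k w - Defs.prev xm1 x k w) - gamma k *: grad f (x k w)).
Proof.
move=> [_ /(_ k w)]; move: (i k w) => a [xa xna].
apply/rowP => j; rewrite 2!mxE.
case: eqP => [ja|/eqP ja].
  move: xa; rewrite -ja => /rowP/(_ (tagnat.sig2 j)).
  by rewrite /pgrad !mxE tagnat.sig2K => ->; ring.
have /rowP/(_ (tagnat.sig2 j)) := xna _ ja.
by rewrite !mxE tagnat.sig2K addr0.
Qed.
End Blocks.

(** * Step sizes and weights *)

Section Params.
Context {R : realType} (m : nat) (L c : R) (beta gamma : nat -> R).
Hypothesis L0 : 0 < L.
Hypothesis betaP : forall k, 0 <= beta k < Num.sqrt m%:R.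
Hypothesis beta_ni : nonincreasing_seq beta.
Hypothesis c01 : 0 < c < 1.
Hypothesis gammaE : forall k, gamma k = 2 * (1 - beta k / Num.sqrt m%:R) * c / L.

Let q : R := Num.sqrt m%:R.

(** What Young's inequality with parameter sqrt m leaves in front of the squared
    increments. *)
Definition weight k : R := beta k / (2 * Num.sqrt m%:R * gamma k).

(** The constant part of delta_bar, equal to L (1 - c) / (4 c); it is also what the
    Lyapunov sequence loses per unit of squared increment. *)
Definition slack : R := 2^-1 * (L / (2 * c) - L / 2).

Lemma sqrtm_gt0 : 0 < q.
Proof. by have /andP[/le_lt_trans h /h] := betaP 0. Qed.

Lemma ratio_itv k : 0 <= beta k / q < 1.
Proof.
have q0 := sqrtm_gt0; have /andP[b0 bq] := betaP k.
by rewrite divr_ge0 ?(ltW q0)//= ltr_pdivrMr// mul1r.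
Qed.

Lemma gamma_gt0 k : 0 < gamma k.
Proof.
have /andP[c0 _] := c01; have /andP[_ b1] := ratio_itv k.
by rewrite gammaE divr_gt0// mulr_gt0// mulr_gt0// subr_gt0.
Qed.

Lemma gamma_nd k l : (k <= l)%N -> gamma k <= gamma l.
Proof.
move=> /beta_ni bkl; have /andP[c0 _] := c01; have q0 := sqrtm_gt0.
rewrite !gammaE ler_pM2r ?invr_gt0// ler_pM2r// ler_pM2l// lerD2l lerN2.
by rewrite ler_pM2r// invr_gt0.
Qed.

Lemma weight_ge0 k : 0 <= weight k.
Proof.
have /andP[b0 _] := betaP k.
by rewrite divr_ge0// mulr_ge0 ?mulr_ge0 ?(ltW (gamma_gt0 k)) ?(ltW sqrtm_gt0).
Qed.

Lemma weight_ni k l : (k <= l)%N -> weight l <= weight k.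
Proof.
move=> kl; have /andP[b0 _] := betaP l; have q0 := sqrtm_gt0.
rewrite ler_pM//; last 2 first.
- exact: beta_ni.
- rewrite lef_pV2 ?posrE ?mulr_gt0 ?gamma_gt0//.
  by rewrite ler_pM2l ?mulr_gt0// gamma_nd.
by rewrite invr_ge0 mulr_ge0 ?mulr_ge0 ?(ltW (gamma_gt0 l)) ?(ltW q0).
Qed.

Lemma slack_gt0 : 0 < slack.
Proof.
have /andP[c0 c1] := c01.
rewrite /slack mulr_gt0// subr_gt0 ltr_pM2l// ltf_pV2 ?posrE ?mulr_gt0//; lra.
Qed.

Lemma delta_barE k : delta_bar m L beta gamma k = weight k + slack.
Proof.
have /andP[c0 c1] := c01; have /andP[_ b1] := ratio_itv k.
have q0 := sqrtm_gt0.
rewrite /delta_bar /weight /slack; congr (_ + _ * (_ - _)).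
rewrite gammaE -/q; have : 1 - beta k / q != 0 by rewrite gt_eqF// subr_gt0.
set y := 1 - _ => y0; field.
by rewrite y0 !gt_eqF.
Qed.

(** The coefficient of the squared new increment in the descent inequality. *)
Lemma weight_gammaE k :
  weight k + L / 2 - (gamma k)^-1 = - (delta_bar m L beta gamma k + slack).
Proof.
have /andP[c0 c1] := c01; have /andP[_ b1] := ratio_itv k.
have q0 := sqrtm_gt0.
rewrite delta_barE /slack /weight gammaE -/q.
have : 1 - beta k / q != 0 by rewrite gt_eqF// subr_gt0.
have -> : beta k / (2 * q * (2 * (1 - beta k / q) * c / L)) =
    beta k / q / (2 * (2 * (1 - beta k / q) * c / L)).
  by rewrite -(mulrA 2 q) (mulrCA 2 q) [in LHS]invfM [LHS]mulrA.
set b := beta k / q => b0; field.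
by rewrite b0 !gt_eqF.
Qed.

(** The sequence is bounded by its value at 0, since the weights decrease and the
    step sizes increase; without an upper bound sup would be 0. *)
Lemma eps_bar_sup_gt0 : 0 < sup (range (eps_bar m L c beta gamma)).
Proof.
have /andP[c0 c1] := c01.
have m0 : 0 < m%:R :> R by rewrite -sqrtr_gt0 sqrtm_gt0.
have A0 : 0 < (1 - c) * L by rewrite mulr_gt0// subr_gt0.
have d0 k : 0 <= delta_bar m L beta gamma k.
  by rewrite delta_barE addr_ge0 ?weight_ge0 ?(ltW slack_gt0).
have ub : ubound (range (eps_bar m L c beta gamma))
                 (eps_bar m L c beta gamma 0%N).
  move=> _ [k _ <-]; rewrite /eps_bar lerD//.
    rewrite ler_pM2r ?invr_gt0// ler_pM2l ?mulr_gt0// ler_pXn2r ?nnegrE//.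
    by rewrite !delta_barE lerD2r weight_ni.
  rewrite ler_pM2l ?mulr_gt0//.
  rewrite lef_pV2 ?posrE ?mulr_gt0 ?exprn_gt0 ?gamma_gt0 ?subr_gt0//.
  rewrite ler_pM2l// ler_pXn2r ?nnegrE ?(ltW (gamma_gt0 _))//.
  exact: gamma_nd.
apply: (@lt_le_trans _ _ (eps_bar m L c beta gamma 0%N)).
  rewrite /eps_bar ltr_wpDl//.
    by rewrite divr_ge0 ?(ltW A0)// mulr_ge0 ?sqr_ge0// mulr_ge0// ltW.
  by rewrite divr_gt0 ?mulr_gt0 ?exprn_gt0 ?gamma_gt0 ?subr_gt0.
apply: ub_le_sup; first by exists (eps_bar m L c beta gamma 0%N).
by exists 0%N.
Qed.
End Params.

(** * Expected behaviour of the scheme *)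

Section Scheme.
Context {R : realType} {m : nat} {n : 'I_m -> nat}.
Variables (f : 'rV[R]_(\sum_i n i) -> R^o) (L c : R) (beta gamma : nat -> R).
Context {d : measure_display} {Omega : measurableType d}.
Variable P : probability Omega R.
Variables (i : nat -> Omega -> 'I_m) (xm1 x0 : 'rV[R]_(\sum_i n i)).
Variable x : nat -> Omega -> 'rV[R]_(\sum_i n i).
Hypothesis df : forall y, differentiable f y.
Hypothesis L0 : 0 < L.
Hypothesis gradL : forall y z, enorm (grad f y - grad f z) <= L * enorm (y - z).
Hypothesis betaP : forall k, 0 <= beta k < Num.sqrt m%:R.
Hypothesis beta_ni : nonincreasing_seq beta.
Hypothesis c01 : 0 < c < 1.
Hypothesis gammaE : forall k, gamma k = 2 * (1 - beta k / Num.sqrt m%:R) * c / L.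
Hypothesis ui : uniform_indep_past P i.
Hypothesis hb : heavy_ball_scd f gamma beta i xm1 x0 x.

Let incr k w := x k w - Defs.prev xm1 x k w.
Let g k w := grad f (x k w).
Let trial k w := beta k *: incr k w - gamma k *: g k w.
Let D k := Ev P (fun w => enorm (incr k w) ^+ 2).
Let F k := Ev P (fun w => f (x k w)).
Let M k := Ev P (fun w => enorm (g k w) ^+ 2).

Lemma incrS k w : incr k.+1 w = block (i k w) (trial k w).
Proof. by rewrite /incr (heavy_ball_step _ _ hb)/= addrAC subrr add0r. Qed.

Lemma past_x k : past i k (x k).
Proof.
suff : past i k (x k) /\ past i k (Defs.prev xm1 x k) by case.
elim: k => [|k [IH1 IH2]].
  by split => // w w' _; case: hb => x00 _; rewrite !x00.
split; last exact: past_leq (leqnSn k) IH1.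
move=> w w' ww'; rewrite !(heavy_ball_step _ _ hb).
have ww j : (j < k)%N -> i j w = i j w' by move=> jk; apply: ww'; exact: leqW.
by rewrite (IH1 _ _ ww) (IH2 _ _ ww) (ww' k).
Qed.

Lemma past_incr k : past i k (incr k).
Proof.
apply: (past_comp2 (fun u v => u - v)); first exact: past_x.
case: k => [|k]; first by move=> w w'.
by have := past_leq (leqnSn k) (@past_x k); exact.
Qed.

Lemma past_f k : past i k (fun w => f (x k w)).
Proof. exact: (past_comp f (@past_x k)). Qed.

Lemma past_g k : past i k (g k).
Proof. exact: (past_comp (grad f) (@past_x k)). Qed.

Lemma past_sqr k (X : Omega -> 'rV[R]_(\sum_i n i)) :
  past i k X -> past i k (fun w => enorm (X w) ^+ 2).
Proof. by move=> pX; exact: (past_comp (fun v => enorm v ^+ 2) pX). Qed.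

(** The blocks partition the coordinates, so that averaging over the random block
    divides the squared norm by m. *)
Lemma Ev_block k (X : Omega -> 'rV[R]_(\sum_i n i)) : past i k X ->
  Ev P (fun w => enorm (block (i k w) (X w)) ^+ 2) =
  m%:R^-1 * Ev P (fun w => enorm (X w) ^+ 2).
Proof.
move=> pX.
rewrite (Ev_step (G := fun w a => enorm (block a (X w)) ^+ 2) ui) => [|a];
  last exact: (past_comp (fun v => enorm (block a v) ^+ 2) pX).
by under eq_fun do rewrite sum_block.
Qed.

Lemma m_gt0 : 0 < m%:R :> R.
Proof. by rewrite -sqrtr_gt0 (sqrtm_gt0 betaP). Qed.

Lemma past_block k (X : Omega -> 'rV[R]_(\sum_i n i)) : past i k X ->
  past i k.+1 (fun w => enorm (block (i k w) (X w)) ^+ 2).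
Proof.
move=> pX; apply: past_sqr; apply: (past_comp2 (fun a v => block a v)).
  exact: past_choice.
exact: past_leq (leqnSn k) pX.
Qed.

(** The decrease before averaging. The block of the previous increment is weighted
    by m because its expectation will divide it by m. *)
Lemma pointwise_decrease k w :
  f (x k.+1 w)
  + (delta_bar m L beta gamma k + slack L c) * enorm (incr k.+1 w) ^+ 2 <=
  f (x k w)
  + weight m beta gamma k * m%:R * enorm (block (i k w) (incr k w)) ^+ 2.
Proof.
have g0 := gamma_gt0 L0 betaP c01 gammaE k.
have q0 := sqrtm_gt0 betaP.
set q := Num.sqrt m%:R in q0.
have qq : q ^+ 2 = m%:R by rewrite sqr_sqrtr// ltW// m_gt0.
have := weight_gammaE L0 betaP c01 gammaE k.
set dk := delta_bar _ _ _ _ _; rewrite -[LHS in LHS = _ -> _]opprK => /oppr_inj <-.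
have := descent df L0 gradL (x k w) (incr k.+1 w).
have -> : x k w + incr k.+1 w = x k.+1 w by rewrite /incr/= addrC subrK.
have := block_step_dot (i k w) (beta k) (gamma k) (incr k w) (g k w).
rewrite /= -/(trial k w) -incrS -/(g k w).
have := dotv_young q (incr k.+1 w) (block (i k w) (incr k w)).
rewrite qq.
set s := dotv _ _; set N1 := enorm _ ^+ 2; set N2 := enorm _ ^+ 2.
set p := dotv _ _ => young pE desc.
have w0 := weight_ge0 L0 betaP c01 gammaE k.
rewrite -mulrA.
have {}pE : p = weight m beta gamma k * (2 * q * s) - (gamma k)^-1 * N1.
  have -> : p = (gamma k)^-1 * (gamma k * p) by rewrite mulKf// gt_eqF.
  rewrite pE mulrBr; congr (_ - _); rewrite /weight -/q; field.
  by rewrite !gt_eqF.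
have := ler_wpM2l w0 young.
lra.
Qed.

Lemma expected_decrease k :
  F k.+1 + (delta_bar m L beta gamma k + slack L c) * D k.+1 <=
  F k + weight m beta gamma k * D k.
Proof.
have p1 := @past_f k.+1.
have p2 := past_sqr (@past_incr k.+1).
have p3 := past_leq (leqnSn k) (@past_f k).
have p4 := past_block (@past_incr k).
have ED : m%:R * Ev P (fun w => enorm (block (i k w) (incr k w)) ^+ 2) = D k.
  by rewrite Ev_block ?mulVKf ?gt_eqF ?m_gt0//; exact: past_incr.
rewrite -ED mulrA -(EvZ ui _ p2) -(EvZ ui _ p4).
rewrite -(EvD ui p1 (past_comp ( *%R _) p2)).
rewrite -(EvD ui p3 (past_comp ( *%R _) p4)).
apply: (Ev_le ui (k := k.+1)); last by move=> w; exact: pointwise_decrease.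
- exact: (past_comp2 +%R p1 (past_comp ( *%R _) p2)).
- exact: (past_comp2 +%R p3 (past_comp ( *%R _) p4)).
Qed.

(** The step size gamma_k is replaced by its least value gamma_0, so that the
    constant does not depend on k. *)
Lemma gradient_bound k : gamma 0%N ^+ 2 * M k <= 2 * m%:R * (D k + D k.+1).
Proof.
have m0 := m_gt0.
have p2 := past_sqr (@past_incr k.+1).
have p4 := past_block (@past_incr k).
have p5 := past_block (@past_g k).
have key : gamma k ^+ 2 * Ev P (fun w => enorm (block (i k w) (g k w)) ^+ 2) <=
    2 * beta k ^+ 2 * Ev P (fun w => enorm (block (i k w) (incr k w)) ^+ 2)
    + 2 * D k.+1.
  rewrite -(EvZ ui _ p2) -(EvZ ui _ p4) -(EvZ ui _ p5).
  rewrite -(EvD ui (past_comp ( *%R _) p4) (past_comp ( *%R _) p2)).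
  apply: (Ev_le ui (k := k.+1)).
  - exact: (past_comp ( *%R _) p5).
  - exact: (past_comp2 +%R (past_comp ( *%R _) p4)
                             (past_comp ( *%R _) p2)).
  - by move=> w; rewrite incrS; exact: block_grad_le.
have MD : 0 <= M k by apply: (Ev_ge0 P) => w; exact: sqr_ge0.
have D0 : 0 <= D k by apply: (Ev_ge0 P) => w; exact: sqr_ge0.
move: key; rewrite (Ev_block (@past_g k)) (Ev_block (@past_incr k)) -/(M k) -/(D k).
have bm : beta k ^+ 2 <= m%:R.
  have /andP[b0 bq] := betaP k.
  rewrite -[m%:R in leRHS](@sqr_sqrtr R)// ?(ltW m0)//.
  by rewrite ler_pXn2r// ?nnegrE// ltW// (sqrtm_gt0 betaP).
have gg : gamma 0%N ^+ 2 <= gamma k ^+ 2.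
  rewrite ler_pXn2r// ?nnegrE ?(ltW (gamma_gt0 L0 betaP c01 gammaE _))//.
  exact: (gamma_nd L0 betaP beta_ni c01 gammaE).
rewrite -(ler_pM2l m0).
have -> : m%:R * (gamma k ^+ 2 * (m%:R^-1 * M k)) = gamma k ^+ 2 * M k.
  by field; rewrite gt_eqF.
have -> : m%:R * (2 * beta k ^+ 2 * (m%:R^-1 * D k) + 2 * D k.+1) =
   2 * (beta k ^+ 2 * D k) + 2 * m%:R * D k.+1.
  by field; rewrite gt_eqF.
have := ler_wpM2r D0 bm; have := ler_wpM2r MD gg; lra.
Qed.

Hypothesis cf : convex_function setT f.

(** Convexity at x^k towards the minimizer p, then Young's inequality under the
    expectation. *)
Lemma gap_bound k (t r fmin : R) (p : Omega -> 'rV[R]_(\sum_i n i)) : 0 < t ->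
  past i k p -> (forall w, f (p w) = fmin) ->
  Ev P (fun w => enorm (x k w - p w) ^+ 2) <= r ->
  2 * t * (F k - fmin) <= M k + t ^+ 2 * r.
Proof.
move=> t0 pp fp rb.
have pg := past_sqr (@past_g k).
have pd : past i k (fun w => enorm (x k w - p w) ^+ 2).
  by apply: past_sqr; apply: (past_comp2 (fun u v => u - v)) => //; exact: past_x.
apply: (@le_trans _ _ (M k + t ^+ 2 *
    Ev P (fun w => enorm (x k w - p w) ^+ 2))); last first.
  by rewrite lerD2l ler_wpM2l// sqr_ge0.
rewrite -(EvZ ui _ pd) -(EvD ui pg (past_comp ( *%R _) pd)).
have pf : past i k (fun w => f (x k w) - fmin).
  exact: (past_comp (fun r : R => r - fmin) (@past_f k)).
have -> : F k - fmin = Ev P (fun w => f (x k w) - fmin).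
  by rewrite (EvD ui (@past_f k) (@past_cst _ _ _ i _ k (- fmin))) Ev_cst.
rewrite -(EvZ ui _ pf); apply: (Ev_le ui (k := k)).
- exact: (past_comp ( *%R _) pf).
- exact: (past_comp2 +%R pg (past_comp ( *%R _) pd)).
move=> w; apply: le_trans (dotv_young t _ _).
rewrite ler_pM2l ?mulr_gt0//.
have := convex_grad df L0 gradL (x k w) (p w - x k w) cf.
rewrite [x k w + _]addrC subrK fp -[p w - _]opprB dotvNr -/(g k w); lra.
Qed.

Hypothesis fmin_ex : argmin f !=set0.
Hypothesis Rfin : (Rbar P f x < +oo)%E.

Let xbar k w := Defs.proj (argmin f) (x k w).

Lemma xbar_argmin k w : argmin f (xbar k w).
Proof. by case: (proj_exists (x k w) (argmin_closed df fmin_ex) fmin_ex). Qed.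

Lemma Rbar_fin_num : Rbar P f x \is a fin_num.
Proof.
rewrite ge0_fin_numE//; apply: ereal_sup_ge.
eexists; first by exists 0%N.
by apply: expectation_ge0 => w; exact: sqr_ge0.
Qed.

Lemma past_dist k : past i k (fun w => enorm (x k w - xbar k w) ^+ 2).
Proof.
exact: (past_comp (fun u => enorm (u - Defs.proj (argmin f) u) ^+ 2) (@past_x k)).
Qed.

Lemma Rbar_ub k :
  Ev P (fun w => enorm (x k w - xbar k w) ^+ 2) <= fine (Rbar P f x).
Proof.
rewrite -lee_fin -(past_expectation ui (@past_dist k)) fineK ?Rbar_fin_num//.
by apply: ereal_sup_ubound; exists k.
Qed.

Lemma gap_ge0 k : 0 <= F k - minval f.
Proof.
have [p fp] := fmin_ex; rewrite (minvalE fp) subr_ge0 -[leLHS](Ev_cst P).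
apply: (Ev_le ui (@past_cst _ _ _ i _ k (f p)) (@past_f k)) => w.
exact: fp.
Qed.

Lemma gap_le k t : 0 < t ->
  2 * t * (F k - minval f) <= M k + t ^+ 2 * fine (Rbar P f x).
Proof.
move=> t0; apply: (gap_bound (p := xbar k)) => //; last exact: Rbar_ub.
  exact: (past_comp (Defs.proj (argmin f)) (@past_x k)).
by move=> w; rewrite (minvalE (xbar_argmin k w)).
Qed.

(** When r = 0, the bound [gap_le] reads 2 t (F_k - min f) <= M_k for all t. *)
Lemma gap_eq0 k : fine (Rbar P f x) = 0 -> F k - minval f = 0.
Proof.
move=> R0; apply/eqP; rewrite eq_le gap_ge0 andbT leNgt; apply/negP => gap0.
have MD : 0 <= M k by apply: (Ev_ge0 P) => w; exact: sqr_ge0.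
have := @gap_le k ((M k + 1) / (F k - minval f)).
rewrite R0 mulr0 addr0 -mulrA divfK ?gt_eqF// => /(_ (divr_gt0 _ gap0)); lra.
Qed.

(** The gap is at most the Lyapunov sequence E_k, to which [young_rate] applies. *)
Lemma gap_rate : 0 < fine (Rbar P f x) ->
  exists K, forall k, k%:R * (F k - minval f) <= K.
Proof.
move=> R0.
pose de := delta_bar m L beta gamma.
pose ka := slack L c.
have ka0 : 0 < ka := slack_gt0 L0 c01.
have m0 := m_gt0.
have D0 k : 0 <= D k by apply: (Ev_ge0 P) => w; exact: sqr_ge0.
have deE k : de k = weight m beta gamma k + ka.
  exact: (delta_barE L0 betaP c01 gammaE k).
have w0 k := weight_ge0 L0 betaP c01 gammaE k.
have w1 k := weight_ni L0 betaP beta_ni c01 gammaE (leqnSn k).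
have w00 k := weight_ni L0 betaP beta_ni c01 gammaE (leq0n k).
have g0 : 0 < gamma 0%N ^+ 2.
  by rewrite exprn_gt0// (gamma_gt0 L0 betaP c01 gammaE).
pose E k := F k - minval f + de k * D k.
have E0 k : 0 <= E k.
  by rewrite addr_ge0 ?gap_ge0// mulr_ge0// deE addr_ge0// ltW.
have dec k : ka * (D k + D k.+1) <= E k - E k.+1.
  have := expected_decrease k; rewrite -/(de k) -/ka /E !deE.
  have := ler_wpM2r (D0 k.+1) (w1 k); lra.
have niE : nonincreasing_seq E.
  apply/nonincreasing_seqP => k; rewrite -subr_ge0; apply: le_trans (dec k).
  by rewrite mulr_ge0 ?addr_ge0// ltW.
have Dh k : D k + D k.+1 <= ka^-1 * (E k - E k.+1).
  by rewrite -(ler_pM2l ka0) mulrA divff ?gt_eqF// mul1r.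
suff [K hK] : exists K, forall k, k%:R * E k <= K.
  exists K => k; apply: le_trans (hK k); rewrite ler_wpM2l// lerDl mulr_ge0//.
  by rewrite deE addr_ge0// ltW.
apply: (@young_rate _ E (2 * m%:R / (gamma 0%N ^+ 2) * ka^-1)
          (de 0%N * ka^-1) _ R0 _ _ E0 niE).
- by rewrite mulr_ge0 ?invr_ge0 ?(ltW ka0)// divr_ge0 ?(ltW g0)// mulr_ge0// ltW.
- by rewrite mulr_ge0 ?invr_ge0 ?(ltW ka0)// deE addr_ge0// ltW.
- move=> k t t0.
  have gapE : E k - de 0%N * ka^-1 * (E k - E k.+1) <= F k - minval f.
    have h1 : de k * D k <= de 0%N * D k by rewrite ler_wpM2r// !deE lerD2r.
    have d00 : 0 <= de 0%N by rewrite deE addr_ge0// ltW.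
    have h2 := ler_wpM2l d00 (Dh k); have h3 := mulr_ge0 d00 (D0 k.+1).
    have -> : F k - minval f = E k - de k * D k by rewrite /E addrK.
    move: h2; rewrite mulrA; lra.
  have tt : 0 <= 2 * t by lra.
  apply: le_trans (ler_wpM2l tt gapE) _; apply: le_trans (gap_le _ t0) _.
  rewrite lerD2r -(ler_pM2l g0); apply: le_trans (gradient_bound k) _.
  have -> : gamma 0%N ^+ 2 *
        (2 * m%:R / gamma 0%N ^+ 2 * ka^-1 * (E k - E k.+1)) =
      2 * m%:R * (ka^-1 * (E k - E k.+1)).
    by field; rewrite !gt_eqF// (gamma_gt0 L0 betaP c01 gammaE).
  by rewrite ler_pM2l ?mulr_gt0.
Qed.

End Scheme.

Theorem theorem6 (R : realType) (m : nat) (n : 'I_m -> nat)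
    (f : 'rV[R]_(\sum_i n i) -> R^o) (L c : R) (beta gamma : nat -> R)
    (d : measure_display) (Omega : measurableType d) (P : probability Omega R)
    (i : nat -> Omega -> 'I_m) (xm1 x0 : 'rV[R]_(\sum_i n i))
    (x : nat -> Omega -> 'rV[R]_(\sum_i n i)) :
  convex_function setT f ->
  (forall y, differentiable f y) ->
  0 < L ->
  (forall y z, enorm (grad f y - grad f z) <= L * enorm (y - z)) ->
  argmin f !=set0 ->
  (forall k, 0 <= beta k < Num.sqrt m%:R) ->
  nonincreasing_seq beta ->
  0 < c < 1 ->
  (forall k, gamma k = 2 * (1 - beta k / Num.sqrt m%:R) * c / L) ->
  uniform_indep_past P i ->
  heavy_ball_scd f gamma beta i xm1 x0 x ->
  (Rbar P f x < +oo)%E ->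
  (fun k : nat => fine ('E_P[fun w => f (x k w)])%E - minval f : R^o) =O_\oo
  (fun k : nat => 4 * fine (Rbar P f x) * sup (range (eps_bar m L c beta gamma))
                  / k%:R : R^o).
Proof.
move=> cf df L0 gradL fmin betaP beta_ni c01 gammaE ui hb Rfin.
set r := fine _; set S := sup _.
have S0 : 0 < S by exact: (eps_bar_sup_gt0 L0 betaP beta_ni c01 gammaE).
have gap0 k := gap_ge0 ui hb fmin k.
(* If r = 0 the comparison function is 0, so the gap has to vanish exactly;
   otherwise the comparison function is a positive multiple of 1/k. *)
have [r0|r0] := eqVneq r 0.
  apply/eqO_exP; exists 1 => //; apply: nearW => k /=.
  have := gap_eq0 df L0 gradL ui hb cf fmin Rfin k r0.
  by rewrite /Ev => ->; rewrite normr0 mul1r.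
have {}r0 : 0 < r.
  rewrite lt_neqAle eq_sym r0 /=.
  apply: le_trans (Rbar_ub ui hb Rfin 0%N); apply: (Ev_ge0 P) => w; exact: sqr_ge0.
have [K hK] := gap_rate df L0 gradL betaP beta_ni c01 gammaE ui hb cf fmin Rfin r0.
have A0 : 0 < 4 * r * S by rewrite !mulr_gt0.
apply/eqO_exP; exists ((`|K| + 1) / (4 * r * S)).
  by rewrite divr_gt0// ltr_wpDl.
near=> k.
have k0 : 0 < k%:R :> R by rewrite ltr0n; near: k; exact: nbhs_infty_gt.
have b0 : 0 <= 4 * r * S / k%:R by rewrite divr_ge0 ?ltW.
rewrite (ger0_norm (gap0 k)) (ger0_norm b0).
rewrite mulrA divfK ?gt_eqF// ler_pdivlMr// mulrC.
apply: le_trans (hK k) _.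
by rewrite (le_trans (ler_norm _))// lerDl.
Unshelve. all: by end_near. Qed.
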